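(* Let $p$ be an odd prime, $q$ a power of $p$, $l\ge 0$ an integer, and $k=2$. Then $D_{p^l+2,k}(1,x)$ is a permutation polynomial of $\mathbb{F}_q$ if and only if $l=0$.
   Context: For an integer $k$ with $0\le k\le p-1$ and an integer $n\ge1$, $D_{n,k}(1,x)=\sum_{i=0}^{\lfloor n/2\rfloor}\frac{n-ki}{n-i}\binom{n-i}{i}(-x)^i\in\mathbb{F}_q[x]$ (the coefficients are integers, reduced mod $p$). A permutation polynomial of $\mathbb{F}_q$ is a polynomial inducing a bijection of $\mathbb{F}_q$. *)

(* Defs.v *)
From mathcomp Require Import all_boot all_order all_algebra.
Set Implicit Arguments.
Unset Strict Implicit.
Unset Printing Implicit Defensive.
Import GRing.Theory.
Local Open Scope ring_scope.

(* Integer coefficient (n - k i)/(n - i) * binom(n - i, i).  The numerator may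
   be negative when k > 2, hence the computation in int.  The division is exact
   for i < n, see dickson_coef_dvd. *)
Definition dickson_coef (n k i : nat) : int :=
  (((n%:Z - (k * i)%:Z) * ('C(n - i, i))%:Z) %/ (n%:Z - i%:Z))%Z.

Lemma dickson_coef_dvd (n k i : nat) : (i < n)%N ->
  (n%:Z - i%:Z %| (n%:Z - (k * i)%:Z) * ('C(n - i, i))%:Z)%Z.
Proof.
move=> lt_in; have le_in := ltnW lt_in; rewrite (subzn le_in).
have dvd_iC : (n - i %| i * 'C(n - i, i))%N.
  case: i lt_in {le_in} => [|i] _; first by rewrite mul0n dvdn0.
  by rewrite -mul_bin_diag dvdn_mulr.
have -> : n%:Z - (k * i)%:Z = (n - i)%N%:Z + (1 - k%:Z) * i%:Z.
  by rewrite -(subzn le_in) mulrBl mul1r PoszM addrA subrK.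
rewrite mulrDl; apply: rpredD; first exact: dvdz_mulr.
by rewrite -mulrA -PoszM dvdz_mull.
Qed.

(* D_{n,k}(1,x). *)
Definition dickson1 (F : nzRingType) (n k : nat) : {poly F} :=
  \sum_(0 <= i < n./2.+1) (dickson_coef n k i)%:~R *: (- 'X) ^+ i.

Definition permutation_poly (F : finFieldType) (f : {poly F}) : Prop :=
  bijective (fun a : F => f.[a]).

(* Main.v *)
Require Import Defs.
From mathcomp Require Import all_boot all_order all_algebra.
From mathcomp Require Import finfield ring zify.
Local Open Scope ring_scope.
Import GRing.Theory.

(** With [t = 1 - 4 x], formally [t = u^2], and [n = p^l + 2], Binet's formula
    for [D_{n,2}(1,x) = \sum_i 'C(n-1-i, i) (-x)^i] and the Frobenius map give
    [4 D_{n,2}(1,x) = 2 + t^m (1 + t)], where [p^l = 2 m + 1].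
    For [l = 0] this is affine in [x]; for [l > 0] it takes the same value at
    [t = 0] and at [t = -1]. *)

(** For [k = 2] the numerator is [(n - i) - i], and absorption, [((n - i) - i) 'C(n - i, i) = (n -
    i) 'C(n - i - 1, i)], cancels the denominator. *)
Lemma dickson_coef2 (n i : nat) :
  (i <= n./2)%N -> (0 < n)%N -> dickson_coef n 2 i = 'C(n.-1 - i, i)%:Z.
Proof.
move=> le_i n_gt0; rewrite /dickson_coef.
have lt_in : (i < n)%N by lia.
have le_2in : (2 * i <= n)%N by lia.
rewrite (subzn (ltnW lt_in)) (subzn le_2in) -PoszM.
have -> : (n - 2 * i = (n - i) - i)%N by lia.
rewrite -mul_bin_down PoszM mulKz; last by lia.
by congr (Posz 'C(_, _)); lia.
Qed.

(** Pascal's rule summed along a diagonal, as for Fibonacci numbers. *)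
Lemma binom_diag_sum_rec (R : comNzRingType) (z : R) (m N : nat) :
  \sum_(0 <= i < N.+1) 'C(m.+2 - i, i)%:R * z ^+ i =
  \sum_(0 <= i < N.+1) 'C(m.+1 - i, i)%:R * z ^+ i
    + z * \sum_(0 <= i < N) 'C(m - i, i)%:R * z ^+ i.
Proof.
rewrite !big_nat_recl // !bin0 -addrA; congr (_ + _).
rewrite mulr_sumr -big_split /=; apply: eq_bigr => i _.
rewrite !subSS exprS.
have -> : 'C(m.+1 - i, i.+1) = ('C(m - i, i.+1) + 'C(m - i, i))%N.
  (* For [i > m] the truncated differences are 0 and all three binomials vanish. *)
  have [le_im | lt_mi] := leqP i m; first by rewrite subSn // binS.
  by rewrite !bin_small //; lia.
by rewrite natrD; ring.
Qed.

(** As [a] and [b] are the roots of [T^2 - T + a b], both sides satisfy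
    [u_(m+2) = u_(m+1) - a b u_m]. Terms with [i > m./2] vanish, so [N] can stay free, which the
    induction needs. *)
Lemma binom_diag_sum_binet (R : comNzRingType) (a b : R) (m N : nat) :
  a + b = 1 -> (m./2 <= N)%N ->
  (a - b) * (\sum_(0 <= i < N.+1) 'C(m - i, i)%:R * (- (a * b)) ^+ i) =
  a ^+ m.+1 - b ^+ m.+1.
Proof.
move=> ab1.
have small (k : nat) : (k < 2)%N -> forall M,
    \sum_(0 <= i < M.+1) 'C(k - i, i)%:R * (- (a * b)) ^+ i = 1.
  move=> lt_k2 M; rewrite big_nat_recl // bin0 big1 ?addr0 ?mulr1 // => i _.
  by rewrite bin_small ?mul0r //; lia.
have b_def : b = 1 - a by rewrite -ab1; ring.
have [k lt_mk] := ubnP m; elim: k m N lt_mk => // k IHk [|[|m]] N lt_mk le_mN.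
- by rewrite small // mulr1 !expr1.
- by rewrite small // mulr1 b_def; ring.
case: N le_mN => [|N] le_mN; first by lia.
rewrite binom_diag_sum_rec mulrDr mulrCA !IHk //; try lia.
by rewrite b_def !exprS; ring.
Qed.

Lemma horner_dickson1_2 (R : comNzRingType) (n : nat) (x : R) : (0 < n)%N ->
  (dickson1 R n 2).[x] =
  \sum_(0 <= i < n./2.+1) 'C(n.-1 - i, i)%:R * (- x) ^+ i.
Proof.
move=> n_gt0; rewrite /dickson1 horner_sum !big_mkord.
apply: eq_bigr => i _.
have le_in : (i <= n./2)%N by rewrite -ltnS.
by rewrite dickson_coef2 // hornerZ horner_exp hornerN hornerX.
Qed.

Lemma pchar_odd_two_neq0 (R : nzRingType) (p : nat) :
  p \in [pchar R] -> odd p -> 2%:R != 0 :> R.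
Proof.
move=> pcharRp; apply: contraTneq => two0.
have := dvdn_pcharf pcharRp 2.
rewrite two0 eqxx dvdn_prime2 ?(pcharf_prime pcharRp) // => /eqP ->.
by [].
Qed.

Lemma dickson1_2_pchar (F : fieldType) (p l : nat) (t : F) :
  p \in [pchar F] -> odd p ->
  4%:R * (dickson1 F (p ^ l + 2) 2).[(1 - t) / 4%:R] =
  2%:R + t ^+ (p ^ l)./2 * (1 + t).
Proof.
move=> pcharFp p_odd; set n := (p ^ l)%N; set m := n./2.
have n_def : n = m.*2.+1.
  by rewrite /m -[LHS]odd_double_half /n oddX p_odd orbT.
have two0 : 2%:R != 0 :> F by exact: pchar_odd_two_neq0 pcharFp p_odd.
(* [P] and [Q] are the two sides with ['X] for [t], and [z] is [- x]. Since [(n + 2)./2 = m + 1],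
   the sum has [m + 2] terms. *)
pose z : {poly F} := - (4%:R^-1%:P * (1 - 'X)).
pose P : {poly F} :=
  4%:R%:P * \sum_(0 <= i < m.+2) 'C(n.+1 - i, i)%:R * z ^+ i.
pose Q : {poly F} := 2%:R%:P + 'X^m * (1 + 'X).
suff PQ : P = Q.
  have <- : Q.[t] = 2%:R + t ^+ m * (1 + t).
    by rewrite /Q !hornerE.
  rewrite -PQ /P hornerM hornerC addn2 horner_dickson1_2 // horner_sum.
  congr (_ * _); apply: eq_bigr => i _.
  by rewrite [_ / 4%:R]mulrC hornerM horner_exp -polyC_natr !hornerE.
(* A square root of [t] need not exist in [F]: work with [t = 'X^2] in [{poly F}]. *)
have PQ2 : P \Po 'X^2 = Q \Po 'X^2.
  (* Now ['X] is the square root of [t], and [a b = (1 - 'X^2) / 4] is [x]. *)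
  pose a : {poly F} := 2%:R^-1%:P * (1 + 'X).
  pose b : {poly F} := 2%:R^-1%:P * (1 - 'X).
  have half2 : 2%:R * (2%:R^-1)%:P = 1 :> {poly F}.
    by rewrite -polyC_natr -polyCM mulfV.
  have ab1 : a + b = 1 by rewrite -half2 /a /b; ring.
  have abX : a - b = 'X by rewrite -['X]mul1r -half2 /a /b; ring.
  have z_def : z \Po 'X^2 = - (a * b).
    rewrite /z /a /b raddfN /= comp_polyM comp_polyB comp_polyX !comp_polyC.
    rewrite -[4%N]/(2 * 2)%N natrM invfM polyCM; ring.
  have sum_def : P \Po 'X^2 =
      4%:R * \sum_(0 <= i < m.+2) 'C(n.+1 - i, i)%:R * (- (a * b)) ^+ i.
    rewrite /P comp_polyM comp_polyC polyC_natr raddf_sum /=; congr (_ * _).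
    apply: eq_bigr => i _.
    by rewrite comp_polyM rmorphXn /= z_def -polyC_natr comp_polyC.
  (* As [n] is a power of the characteristic, raising to the power [n] is additive. *)
  have pnat_n : [pchar {poly F}].-nat n.
    rewrite (eq_pnat _ (@pchar_poly F)) pnatX (eq_pnat _ (pcharf_eq pcharFp)).
    by rewrite pnat_id ?(pcharf_prime pcharFp).
  have ABn1 : a ^+ n + b ^+ n = 1 by rewrite -exprDn_pchar // ab1 expr1n.
  have ABnX : a ^+ n = 'X^n + b ^+ n.
    by rewrite -exprDn_pchar // -abX subrK.
  have Xn : 'X^n = 'X * ('X^2) ^+ m :> {poly F}.
    by rewrite n_def exprS -exprM mul2n.
  have X0 : 'X != 0 :> {poly F} by rewrite polyX_eq0.
  (* The factor ['X = a - b] is the one Binet's formula requires. *)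
  apply: (mulfI X0).
  rewrite sum_def mulrCA -{1}abX binom_diag_sum_binet //; last first.
    by rewrite n_def /=; lia.
  rewrite /Q comp_polyD comp_polyM comp_polyC comp_Xn_poly.
  rewrite comp_polyD comp_polyX polyC_natr -[1 in X in _ = X]/(1%:P) comp_polyC.
  (* Everything is rewritten in [b] and [b ^+ n]; the resulting identity holds with these two
     independent. *)
  have a_def : a = 1 - b by rewrite -ab1 addrK.
  have an_def : a ^+ n = 1 - b ^+ n by rewrite -ABn1 addrK.
  have Xn_def : 'X^n = 1 - b ^+ n *+ 2 by rewrite -ABn1 ABnX; ring.
  rewrite polyC1 [RHS]mulrDr ['X * (_ * _)]mulrA -Xn Xn_def (exprS a) (exprS a) an_def.
  rewrite (exprS b) (exprS b) -abX a_def.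
  by move: (b ^+ n) => bn; ring.
(* Substituting ['X^2] is injective: coefficient [i] moves to degree [2 i]. *)
apply/polyP => i; have := congr1 (fun r : {poly F} => r`_(i * 2)) PQ2.
by rewrite !coef_comp_poly_Xn // dvdn_mull // mulnK.
Qed.

Theorem theorem2p15 (p q e l : nat) (F : finFieldType)
  (p_prime : prime p) (p_odd : odd p)
  (e_gt0 : (0 < e)%N) (q_def : q = (p ^ e)%N) (card_F : #|F| = q) :
  permutation_poly (dickson1 F (p ^ l + 2) 2) <-> l = 0%N.
Proof.
have pcharFp : p \in [pchar F] by apply: (@card_finPcharP F p e); rewrite // -q_def.
have two0 : 2%:R != 0 :> F by exact: pchar_odd_two_neq0 pcharFp p_odd.
have four0 : 4%:R != 0 :> F by rewrite -[4%N]/(2 * 2)%N natrM mulf_neq0.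
have formula l' t := dickson1_2_pchar F p l' t pcharFp p_odd.
split=> [/bij_inj D_inj | ->].
- apply/eqP; rewrite -leqn0 leqNgt; apply/negP => l_gt0.
  have m_gt0 : (0 < (p ^ l)./2)%N.
    rewrite half_gt0; apply: (@leq_trans p); first exact: prime_gt1.
    by rewrite -[X in (X <= _)%N]expn1 leq_exp2l // prime_gt1.
  (* At [t = 0] the factor [t^m] vanishes because [m > 0]; at [t = -1] the factor [1 + t] does. Both
     values are 2. *)
  have : (1 - 0) / 4%:R = (1 - (- 1)) / 4%:R :> F.
    apply: D_inj; apply: (mulfI four0); rewrite !formula.
    by rewrite addrN mulr0 expr0n eqn0Ngt m_gt0 mul0r.
  move/(divIf four0)/eqP; rewrite subr0 opprK -subr_eq0 opprD addNKr.
  by rewrite oppr_eq0 oner_eq0.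
- apply: injF_bij => x y Dxy.
  (* Here [m = 0], so the formula reads [3 + t] with [t = 1 - 4 z]. *)
  have affine (z : F) : 4%:R * (dickson1 F (p ^ 0 + 2) 2).[z] = 4%:R - 4%:R * z.
    have {1}-> : z = (1 - (1 - 4%:R * z)) / 4%:R by rewrite subKr mulrC mulKf.
    by rewrite formula expn0 expr0; ring.
  apply: (mulfI four0); apply: (addrI (- 4%:R)); apply: oppr_inj.
  by rewrite !opprD opprK -!affine Dxy.
Qed.
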